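(* Let $\mathcal{R}$ be a $*$-ring of characteristic 2, let $\mathcal{V}$ be an indefinite inner product module (IIPM) over $\mathcal{R}$, and let $T:\mathcal{V}\to\mathcal{V}$ be a self-adjoint morphism. Let $U=(u_{n,m})_{n,m\in\mathbb{Z}}$ be the morphism on $\oplus_{n=-\infty}^{\infty}\mathcal{V}$ given by the infinite matrix with entries $$u_{0,0}:=T,\quad u_{0,1}:=I_{\mathcal{V}}+T,\quad u_{-1,0}:=I_{\mathcal{V}}+T,\quad u_{-1,1}:=T,$$ $$u_{n,n+1}:=I_{\mathcal{V}}\ \text{ for all } n\in\mathbb{Z},\ n\neq -1,0,\qquad u_{n,m}:=0\ \text{ otherwise}.$$ Then $U$ is unitary on $\oplus_{n=-\infty}^{\infty}\mathcal{V}$ and $$T^n=P_{\mathcal{V}}U^n|_{\mathcal{V}}\quad\text{and}\quad (T^* )^n=P_{\mathcal{V}}(U^* )^n|_{\mathcal{V}}\qquad\text{for all } n\in\mathbb{N},$$ where $P_{\mathcal{V}}:\oplus_{n=-\infty}^{\infty}\mathcal{V}\to\mathcal{V}$, $(x_n)_{n=-\infty}^{\infty}\mapsto x_0$, and $|_{\mathcal{V}}$ denotes restriction to the copy of $\mathcal{V}$ in position $0$, i.e. to the sequences $(x_n)_n$ with $x_n=0$ for all $n\ne 0$.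
   Context: A $*$-ring is a ring $\mathcal{R}$ with an automorphism $*$ which is either the identity or of order 2. Characteristic 2 means $r+r=0$ for all $r\in\mathcal{R}$. A module $\mathcal{V}$ over $\mathcal{R}$ is an indefinite inner product module (IIPM) if it is equipped with a map $\langle\cdot,\cdot\rangle:\mathcal{V}\times\mathcal{V}\to\mathcal{R}$ such that: (i) if $x\in\mathcal{V}$ satisfies $\langle x,y\rangle=0$ for all $y\in\mathcal{V}$, then $x=0$; (ii) $\langle x,y\rangle=\langle y,x\rangle^*$ for all $x,y\in\mathcal{V}$; (iii) $\langle ax+y,z\rangle=a\langle x,z\rangle+\langle y,z\rangle$ for all $a\in\mathcal{R}$ and $x,y,z\in\mathcal{V}$. A morphism is an $\mathcal{R}$-module homomorphism; $I_{\mathcal{V}}$ is the identity on $\mathcal{V}$. A morphism $T:\mathcal{V}\to\mathcal{V}$ is adjointable if there is a morphism $T^*:\mathcal{V}\to\mathcal{V}$ with $\langle Tx,y\rangle=\langle x,T^*y\rangle$ for all $x,y\in\mathcal{V}$ (by (i), $T^*$ is unique if it exists). An adjointable morphism $T$ is self-adjoint if $T^*=T$. An adjointable morphism $U$ on an IIPM $\mathcal{W}$ is unitary if $UU^*=U^*U=I_{\mathcal{W}}$. The IIPM $\oplus_{n=-\infty}^{\infty}\mathcal{V}$ consists of all sequences $\{x_n\}_{n=-\infty}^{\infty}$ with $x_n\in\mathcal{V}$ for all $n\in\mathbb{Z}$ and $x_n\neq 0$ for only finitely many $n$, with inner product $\langle\{x_n\},\{y_n\}\rangle:=\sum_{n=-\infty}^{\infty}\langle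 x_n,y_n\rangle$. A matrix $(u_{n,m})$ of morphisms of $\mathcal{V}$ acts by $(Ux)_n=\sum_m u_{n,m}x_m$. *)

(* Defs.v *)
From HB Require Import structures.
From mathcomp Require Import all_boot all_order all_algebra finmap.

Set Implicit Arguments.
Unset Strict Implicit.
Unset Printing Implicit Defensive.

Import GRing.Theory.
Local Open Scope fset_scope.
Local Open Scope ring_scope.

(* Rings are unital, but neither commutative nor nontrivial. "The identity or
   of order 2" is rendered as [involutive]. Note that the involution preserves
   the order of products. *)
HB.mixin Record PzRing_isStarRing R of GRing.PzRing R := {
  star : {rmorphism R -> R};
  starK : involutive star
}.

#[short(type="starRingType")]
HB.structure Definition StarRing := {R of GRing.PzRing R & PzRing_isStarRing R}.

Definition char_two (R : starRingType) : Prop := forall r : R, r + r = 0.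

HB.mixin Record Lmodule_isIIPM (R : starRingType) V of GRing.Lmodule R V := {
  inner : V -> V -> R;
  inner_nondeg : forall x, (forall y, inner x y = 0) -> x = 0;
  inner_sym : forall x y, inner x y = star (inner y x);
  inner_linear : forall a x y z,
    inner (a *: x + y) z = a * inner x z + inner y z
}.

#[short(type="iipmType")]
HB.structure Definition IIPM (R : starRingType) :=
  {V of GRing.Lmodule R V & Lmodule_isIIPM R V}.

Section Adjoints.
Variables (R : starRingType) (V : iipmType R).

Lemma inner0l (z : V) : inner 0 z = 0.
Proof.
have := inner_linear 1 0 0 z; rewrite scaler0 addr0 mul1r => /eqP.
by rewrite -subr_eq0 opprD addrA subrr sub0r oppr_eq0 => /eqP.
Qed.

Lemma innerDl (x y z : V) : inner (x + y) z = inner x z + inner y z.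
Proof. by have := inner_linear 1 x y z; rewrite scale1r mul1r. Qed.

Lemma inner0r (z : V) : inner z 0 = 0.
Proof. by rewrite inner_sym inner0l rmorph0. Qed.

Lemma innerDr (x y z : V) : inner x (y + z) = inner x y + inner x z.
Proof. by rewrite inner_sym innerDl rmorphD -!inner_sym. Qed.

Lemma innerNl (x z : V) : inner (- x) z = - inner x z.
Proof. by apply/eqP; rewrite -addr_eq0 -innerDl addNr inner0l. Qed.

Lemma inner_injl (x y : V) : (forall z, inner x z = inner y z) -> x = y.
Proof.
move=> xy; apply/eqP; rewrite -subr_eq0; apply/eqP/inner_nondeg => z.
by rewrite innerDl innerNl xy subrr.
Qed.

(* [adjoint_of T S] means "T is adjointable and T^* = S"; see [adjoint_uniq]. *)
Definition adjoint_of (T S : {linear V -> V}) : Prop :=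
  forall x y : V, inner (T x) y = inner x (S y).

Lemma adjoint_uniq (T S S' : {linear V -> V}) :
  adjoint_of T S -> adjoint_of T S' -> S =1 S'.
Proof.
move=> TS TS' y; apply: inner_injl => z.
by rewrite inner_sym -TS TS' -inner_sym.
Qed.

Definition self_adjoint (T : {linear V -> V}) : Prop := adjoint_of T T.

Definition unitary (U : {linear V -> V}) : Prop :=
  exists Us : {linear V -> V},
    [/\ adjoint_of U Us, (forall x, U (Us x) = x) & (forall x, Us (U x) = x)].

End Adjoints.

Definition dsum (I : choiceType) (V : nmodType) : Type :=
  {fsfun I -> V with 0}.

HB.instance Definition _ (I : choiceType) (V : nmodType) :=
  Choice.copy (dsum I V) {fsfun I -> V with 0}.

Section DsumZmodule.
Variables (I : choiceType) (V : zmodType).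
Implicit Types x y z : dsum I V.

Definition dsum_zero : dsum I V := [fsfun].
Definition dsum_opp x : dsum I V := [fsfun i in finsupp x => - x i].
Definition dsum_add x y : dsum I V :=
  [fsfun i in finsupp x `|` finsupp y => x i + y i].

Fact dsum_zeroE i : dsum_zero i = 0.
Proof. by rewrite fsfunE. Qed.

Fact dsum_oppE x i : dsum_opp x i = - x i.
Proof. by rewrite fsfunE; case: finsuppP; rewrite ?oppr0. Qed.

Fact dsum_addE x y i : dsum_add x y i = x i + y i.
Proof.
by rewrite fsfunE in_fsetU; do 2!case: finsuppP => ? //=; rewrite addr0.
Qed.

Fact dsum_addA : associative dsum_add.
Proof. by move=> x y z; apply/fsfunP => i; rewrite !dsum_addE addrA. Qed.

Fact dsum_addC : commutative dsum_add.
Proof. by move=> x y; apply/fsfunP => i; rewrite !dsum_addE addrC. Qed.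

Fact dsum_add0 : left_id dsum_zero dsum_add.
Proof. by move=> x; apply/fsfunP => i; rewrite dsum_addE dsum_zeroE add0r. Qed.

Fact dsum_addN : left_inverse dsum_zero dsum_opp dsum_add.
Proof.
by move=> x; apply/fsfunP => i; rewrite dsum_addE dsum_oppE addNr dsum_zeroE.
Qed.

HB.instance Definition _ := GRing.isZmodule.Build (dsum I V)
  dsum_addA dsum_addC dsum_add0 dsum_addN.

Lemma dsum0E i : (0 : dsum I V) i = 0. Proof. exact: dsum_zeroE. Qed.
Lemma dsumDE x y i : (x + y) i = x i + y i. Proof. exact: dsum_addE. Qed.
Lemma dsumNE x i : (- x) i = - x i. Proof. exact: dsum_oppE. Qed.

Definition dsum_in (i : I) (v : V) : dsum I V := [fsfun [fsfun] with i |-> v].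

Lemma dsum_inE i v j : dsum_in i v j = if j == i then v else 0.
Proof. by rewrite fsfun_withE fsfunE. Qed.

Definition dsum_proj (i : I) (x : dsum I V) : V := x i.

Lemma sum_finsupp (M : nmodType) (A : {fset I}) (F : I -> V -> M) x :
    (forall i, F i 0 = 0) -> finsupp x `<=` A ->
  \sum_(i <- finsupp x) F i (x i) = \sum_(i <- A) F i (x i).
Proof.
move=> F0 xA; apply: big_fset_incl => // i _ xi.
by rewrite fsfun_dflt.
Qed.

End DsumZmodule.

Section DsumModule.
Variables (R : pzRingType) (I : choiceType) (V : lmodType R).
Implicit Types x y z : dsum I V.

Definition dsum_scale (a : R) x : dsum I V := [fsfun i in finsupp x => a *: x i].

Fact dsum_scaleE a x i : dsum_scale a x i = a *: x i.
Proof. by rewrite fsfunE; case: finsuppP; rewrite ?scaler0. Qed.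

Fact dsum_scaleA a b x : dsum_scale a (dsum_scale b x) = dsum_scale (a * b) x.
Proof. by apply/fsfunP => i; rewrite !dsum_scaleE scalerA. Qed.

Fact dsum_scale1 : left_id 1 dsum_scale.
Proof. by move=> x; apply/fsfunP => i; rewrite dsum_scaleE scale1r. Qed.

Fact dsum_scaleDr : right_distributive dsum_scale +%R.
Proof.
by move=> a x y; apply/fsfunP => i; rewrite !(dsumDE, dsum_scaleE) scalerDr.
Qed.

Fact dsum_scaleDl x : {morph dsum_scale^~ x : a b / a + b}.
Proof.
by move=> a b; apply/fsfunP => i; rewrite !(dsumDE, dsum_scaleE) scalerDl.
Qed.

HB.instance Definition _ := GRing.Zmodule_isLmodule.Build R (dsum I V)
  dsum_scaleA dsum_scale1 dsum_scaleDr dsum_scaleDl.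

Lemma dsumZE a x i : (a *: x) i = a *: x i. Proof. exact: dsum_scaleE. Qed.

End DsumModule.

Section DsumInner.
Variables (R : starRingType) (I : choiceType) (V : iipmType R).
Implicit Types x y z : dsum I V.

Definition dsum_inner x y : R := \sum_(i <- finsupp x) inner (x i) (y i).

Lemma dsum_innerE (A : {fset I}) x y : finsupp x `<=` A ->
  dsum_inner x y = \sum_(i <- A) inner (x i) (y i).
Proof.
by apply: (sum_finsupp (F := fun i v => inner v (y i))) => i; rewrite inner0l.
Qed.

Fact dsum_inner_in x i v : dsum_inner x (dsum_in i v) = inner (x i) v.
Proof.
rewrite (dsum_innerE _ (fsubsetUr [fset i] (finsupp x))).
rewrite (big_fsetD1 i) /= ?in_fset1U ?eqxx // dsum_inE eqxx.
rewrite big_seq big1 ?addr0 // => j; rewrite in_fsetD1 => /andP[/negPf ji _].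
by rewrite dsum_inE ji inner0r.
Qed.

Fact dsum_inner_nondeg x : (forall y, dsum_inner x y = 0) -> x = 0.
Proof.
move=> x0; apply/fsfunP => i; rewrite dsum0E; apply: inner_nondeg => v.
by rewrite -dsum_inner_in x0.
Qed.

Fact dsum_inner_sym x y : dsum_inner x y = star (dsum_inner y x).
Proof.
rewrite (dsum_innerE _ (fsubsetUl _ (finsupp y))).
rewrite (dsum_innerE _ (fsubsetUr (finsupp x) _)) rmorph_sum.
by apply: eq_bigr => i _; rewrite inner_sym.
Qed.

Fact dsum_inner_linear a x y z :
  dsum_inner (a *: x + y) z = a * dsum_inner x z + dsum_inner y z.
Proof.
pose A := finsupp (a *: x + y) `|` (finsupp x `|` finsupp y).
rewrite !(dsum_innerE (A := A)) ?fsubsetUl //; last 2 first.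
- exact: fsubset_trans (fsubsetUr _ _) (fsubsetUr _ _).
- exact: fsubset_trans (fsubsetUl _ _) (fsubsetUr _ _).
rewrite mulr_sumr -big_split; apply: eq_bigr => i _ /=.
by rewrite dsumDE dsumZE inner_linear.
Qed.

HB.instance Definition _ := Lmodule_isIIPM.Build R (dsum I V)
  dsum_inner_nondeg dsum_inner_sym dsum_inner_linear.

End DsumInner.

(* An infinite matrix defines a morphism of the direct sum only if each column
   has finitely many nonzero entries: [mxrows m] contains their row indices. *)
Record opmatrix (R : pzRingType) (I : choiceType) (V : lmodType R) := OpMatrix {
  mxentry :> I -> I -> {linear V -> V};
  mxrows : I -> {fset I};
  mxrowsP : forall n m, n \notin mxrows m -> forall v, mxentry n m v = 0
}.

Section MatrixAction.
Variables (R : pzRingType) (I : choiceType) (V : lmodType R).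
Variable u : opmatrix I V.

Definition mxaction (x : dsum I V) : dsum I V :=
  [fsfun n in \bigcup_(m <- finsupp x) mxrows u m =>
     \sum_(m <- finsupp x) u n m (x m)].

Lemma mxactionE x n : mxaction x n = \sum_(m <- finsupp x) u n m (x m).
Proof.
rewrite fsfunE; case: ifPn => // nx; rewrite big_seq big1 // => m mx.
apply: mxrowsP; apply: contra nx => nm.
by apply/bigfcupP; exists m; rewrite ?mx.
Qed.

Lemma mxactionE_sub (A : {fset I}) x n : finsupp x `<=` A ->
  mxaction x n = \sum_(m <- A) u n m (x m).
Proof.
rewrite mxactionE; apply: (sum_finsupp (F := fun m v => u n m v)) => m.
exact: linear0.
Qed.

Fact mxaction_linear : linear mxaction.
Proof.
move=> a x y; apply/fsfunP => n; rewrite dsumDE dsumZE.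
pose A := finsupp (a *: x + y) `|` (finsupp x `|` finsupp y).
rewrite !(mxactionE_sub (A := A)) ?fsubsetUl //; last 2 first.
- exact: fsubset_trans (fsubsetUr _ _) (fsubsetUr _ _).
- exact: fsubset_trans (fsubsetUl _ _) (fsubsetUr _ _).
rewrite scaler_sumr -big_split; apply: eq_bigr => m _ /=.
by rewrite dsumDE dsumZE linearP.
Qed.

HB.instance Definition _ :=
  GRing.isLinear.Build R (dsum I V) (dsum I V) _ mxaction mxaction_linear.

End MatrixAction.

Section Dilation.
Variables (R : pzRingType) (V : lmodType R) (T : {linear V -> V}).

Definition dilation_entry (n m : int) : {linear V -> V} :=
  if (n == 0) && (m == 0) then T
  else if (n == 0) && (m == 1) then (idfun \+ T : {linear V -> V})
  else if (n == -1) && (m == 0) then (idfun \+ T : {linear V -> V})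
  else if (n == -1) && (m == 1) then T
  else if m == n + 1 then (idfun : {linear V -> V})
  else (\0 : {linear V -> V}).

Fact dilation_rowsP (n m : int) :
  n \notin [fset m; m - 1; m - 2] -> forall v, dilation_entry n m v = 0.
Proof.
rewrite !inE !negb_or -andbA => /and3P[nm nm1 nm2] v; rewrite /dilation_entry.
case: ifP => [/andP[/eqP n0 /eqP m0]|_]; first by rewrite n0 m0 in nm.
case: ifP => [/andP[/eqP n0 /eqP m0]|_]; first by rewrite n0 m0 in nm1.
case: ifP => [/andP[/eqP n0 /eqP m0]|_]; first by rewrite n0 m0 in nm1.
case: ifP => [/andP[/eqP n0 /eqP m0]|_]; first by rewrite n0 m0 in nm2.
by case: eqP => // m1; rewrite m1 addrK eqxx in nm1.
Qed.

Definition dilation_matrix : opmatrix int V := OpMatrix dilation_rowsP.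

Definition dilation : {linear dsum int V -> dsum int V} :=
  mxaction dilation_matrix.

End Dilation.

(* Main.v *)
(** The only part of [U] that is not a shift is the block [[T, 1 + T], [1 + T, T]]
    joining columns 0, 1 to rows 0, -1. In characteristic 2 its square is the
    identity, because [T^2 + (1 + T)^2 = 1] and [2 T (1 + T) = 0]; as its entries
    are self-adjoint, [U] is unitary and its adjoint is given by the transposed
    matrix. [U] preserves the sequences vanishing at all positive positions and
    acts as [T] on their entry at 0; [U^*] does the same with negative positions. *)
Require Import Defs.
From HB Require Import structures.
From mathcomp Require Import all_boot all_order all_algebra finmap.
From mathcomp Require Import zify.

Set Implicit Arguments.
Unset Strict Implicit.
Unset Printing Implicit Defensive.

Import GRing.Theory.
Local Open Scope ring_scope.

Lemma char_two_addvv (R : starRingType) (V : lmodType R) (v : V) :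
  char_two R -> v + v = 0.
Proof. by move=> R2; rewrite -[v]scale1r -scalerDl R2 scale0r. Qed.

Section InnerSum.
Variables (R : starRingType) (V : iipmType R).

Lemma inner_suml (J : Type) (s : seq J) (F : J -> V) (y : V) :
  inner (\sum_(j <- s) F j) y = \sum_(j <- s) inner (F j) y.
Proof. exact: (big_morph (inner^~ y) (fun a b => innerDl a b y) (inner0l y)). Qed.

Lemma inner_sumr (J : Type) (s : seq J) (F : J -> V) (x : V) :
  inner x (\sum_(j <- s) F j) = \sum_(j <- s) inner x (F j).
Proof. exact: (big_morph (inner x) (innerDr x) (inner0r x)). Qed.

(** By symmetry the sum may run over the support of the second argument, so the support of an image
    under a matrix never has to be computed. *)
Lemma dsum_inner_finsuppr (I : choiceType) (x y : dsum I V) :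
  inner x y = \sum_(i <- finsupp y) inner (x i) (y i).
Proof.
by rewrite inner_sym rmorph_sum; apply: eq_bigr => i _; rewrite -inner_sym.
Qed.

(** Both inner products expand to one double sum over [finsupp x] and [finsupp y], up to the order
    of summation. *)
Lemma adjoint_mxaction (I : choiceType) (u w : opmatrix I V) :
  (forall n m, adjoint_of (u n m) (w m n)) ->
  adjoint_of (mxaction u) (mxaction w).
Proof.
move=> uw x y; rewrite dsum_inner_finsuppr.
under eq_bigr do rewrite mxactionE inner_suml.
rewrite exchange_big; apply: eq_bigr => m _ /=.
by rewrite mxactionE inner_sumr; apply: eq_bigr => n _; apply: uw.
Qed.

End InnerSum.

Section MatrixRows.
Variables (R : pzRingType) (I : choiceType) (V : lmodType R).
Variable u : opmatrix I V.

(** Trades the support of [x] for that of row [n], which gives closed formulas valid for every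
    [x]. *)
Lemma mxaction_row (s : seq I) (x : dsum I V) (n : I) : uniq s ->
    (forall m, m \notin s -> forall v, u n m v = 0) ->
  mxaction u x n = \sum_(m <- s) u n m (x m).
Proof.
move=> s_uniq u0; pose A := [fset m in s]%fset.
(* Both sums extend to the union of the two supports: outside either one the terms vanish. *)
rewrite (mxactionE_sub u n (fsubsetUl _ A)).
transitivity (\sum_(m <- A) u n m (x m)).
  apply/esym/big_fset_incl; first exact: fsubsetUr.
  by move=> m _ mA; apply: u0; rewrite in_fset in mA.
by apply: perm_big; apply: uniq_perm => // m; rewrite in_fset.
Qed.

End MatrixRows.

Section Transpose.
Variables (R : pzRingType) (V : lmodType R) (T : {linear V -> V}).

(** Column [m] of the transpose is row [m] of the dilation, so the bound is [dilation_rowsP] solved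
    for the other index. *)
Fact dilation_colsP (n m : int) :
  n \notin [fset m; (m + 1)%R; (m + 2)%R]%fset ->
  forall v, dilation_entry T m n v = 0.
Proof.
move=> nm; apply: dilation_rowsP; apply: contra nm.
by rewrite !inE; lia.
Qed.

Definition dilation_trmx : opmatrix int V := OpMatrix dilation_colsP.

Definition dilation_adj : {linear dsum int V -> dsum int V} :=
  mxaction dilation_trmx.

Implicit Type x : dsum int V.

Lemma dilationE x n : dilation T x n =
  if n == 0 then T (x 0) + (x 1 + T (x 1))
  else if n == -1 then (x 0 + T (x 0)) + T (x 1)
  else x (n + 1).
Proof.
rewrite /dilation; case: ifP => [/eqP ->|n0]; last case: ifP => [/eqP ->|n1].
- rewrite (mxaction_row (s := [:: 0; 1])) // ?big_cons ?big_nil ?addr0 //.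
  move=> m; rewrite !inE => ms v /=; rewrite /dilation_entry.
  by do ![case: ifP => [h|_]; first by exfalso; lia].
- rewrite (mxaction_row (s := [:: 0; 1])) // ?big_cons ?big_nil ?addr0 //.
  move=> m; rewrite !inE => ms v /=; rewrite /dilation_entry.
  by do ![case: ifP => [h|_]; first by exfalso; lia].
- rewrite (mxaction_row (s := [:: n + 1])) //.
    by rewrite big_seq1 /= /dilation_entry n0 n1 eqxx.
  move=> m; rewrite !inE => ms v /=; rewrite /dilation_entry n0 n1 /=.
  by rewrite (negPf ms).
Qed.

Lemma dilation_adjE x n : dilation_adj x n =
  if n == 0 then T (x 0) + (x (-1) + T (x (-1)))
  else if n == 1 then (x 0 + T (x 0)) + T (x (-1))
  else x (n - 1).
Proof.
rewrite /dilation_adj.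
case: ifP => [/eqP ->|n0]; last case: ifP => [/eqP ->|n1].
- rewrite (mxaction_row (s := [:: 0; -1])) // ?big_cons ?big_nil ?addr0 //.
  move=> m; rewrite !inE => ms v /=; rewrite /dilation_entry.
  by do ![case: ifP => [h|_]; first by exfalso; lia].
- rewrite (mxaction_row (s := [:: 0; -1])) // ?big_cons ?big_nil ?addr0 //.
  move=> m; rewrite !inE => ms v /=; rewrite /dilation_entry.
  by do ![case: ifP => [h|_]; first by exfalso; lia].
- rewrite (mxaction_row (s := [:: n - 1])) //.
    by rewrite big_seq1 /= /dilation_entry n0 n1 !andbF subrK eqxx.
  move=> m; rewrite !inE => ms v /=; rewrite /dilation_entry n0 n1 !andbF.
  by case: ifP => // h; exfalso; lia.
Qed.

(** The vanishing clause makes the induction work: the new entry at 0 is [T (x 0)] plus terms in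
    [x 1]. *)
Lemma iter_dilation k (v : V) :
  let x := iter k (dilation T) (dsum_in 0 v) in
  x 0 = iter k T v /\ (forall m : int, 0 < m -> x m = 0).
Proof.
elim: k => [|k [IH0 IH]] /=.
  by split=> [|m m0]; rewrite dsum_inE //; case: eqP => // h; exfalso; lia.
split=> [|m m0]; rewrite dilationE.
  by rewrite eqxx IH0 IH // linear0 !addr0.
(* Rows [m > 0] lie outside the block and read position [m + 1], again positive. *)
by do 2![case: eqP => [h|_]; first by exfalso; lia]; apply: IH; lia.
Qed.

Lemma iter_dilation_adj k (v : V) :
  let x := iter k dilation_adj (dsum_in 0 v) in
  x 0 = iter k T v /\ (forall m : int, m < 0 -> x m = 0).
Proof.
elim: k => [|k [IH0 IH]] /=.
  by split=> [|m m0]; rewrite dsum_inE //; case: eqP => // h; exfalso; lia.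
split=> [|m m0]; rewrite dilation_adjE.
  by rewrite eqxx IH0 IH // linear0 !addr0.
by do 2![case: eqP => [h|_]; first by exfalso; lia]; apply: IH; lia.
Qed.

End Transpose.

Lemma dilation_entry_self_adjoint (R : starRingType) (V : iipmType R)
    (T : {linear V -> V}) n m :
  self_adjoint T -> self_adjoint (dilation_entry T n m).
Proof.
move=> TT x y; rewrite /dilation_entry.
by do !case: ifP => _ /=; rewrite ?(innerDl, innerDr, inner0l, inner0r) ?TT.
Qed.

Lemma dilation_adjP (R : starRingType) (V : iipmType R) (T : {linear V -> V}) :
  self_adjoint T -> adjoint_of (dilation T) (dilation_adj T).
Proof.
by move=> TT; apply: adjoint_mxaction => n m; apply: dilation_entry_self_adjoint.
Qed.

Lemma dilation_blockK1 (R : starRingType) (V : lmodType R)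
    (T : {linear V -> V}) (a b : V) : char_two R ->
  T (T a + (b + T b)) + ((a + T a + T b) + T (a + T a + T b)) = a.
Proof.
move=> R2; rewrite !linearD /= !addrA.
(* Of the nine terms, the fourth is [a]; the others pair up as [T (T a)], [T b], [T (T b)], [T a],
   each occurring twice. *)
rewrite [LHS](ACl (4*(1*8)*(2*6)*(3*9)*(5*7))) /=.
by rewrite !(char_two_addvv _ R2) !addr0.
Qed.

Lemma dilation_blockK2 (R : starRingType) (V : lmodType R)
    (T : {linear V -> V}) (a b : V) : char_two R ->
  (T a + (b + T b) + T (T a + (b + T b))) + T (a + T a + T b) = b.
Proof.
move=> R2; rewrite !linearD /= !addrA.
rewrite [LHS](ACl (2*(1*7)*(3*5)*(4*8)*(6*9))) /=.
by rewrite !(char_two_addvv _ R2) !addr0.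
Qed.

Lemma dilationK (R : starRingType) (V : lmodType R) (T : {linear V -> V}) :
  char_two R -> cancel (dilation T) (dilation_adj T).
Proof.
move=> R2 x; apply/fsfunP => n; rewrite dilation_adjE !dilationE /=.
case: eqP => [->|n0]; first exact: dilation_blockK1.
case: eqP => [->|n1]; first exact: dilation_blockK2.
(* As [n] is neither 0 nor 1, [n - 1] is neither -1 nor 0, so two opposite shifts cancel. *)
by do 2![case: eqP => [h|_]; first by exfalso; lia]; rewrite subrK.
Qed.

Lemma dilation_adjK (R : starRingType) (V : lmodType R) (T : {linear V -> V}) :
  char_two R -> cancel (dilation_adj T) (dilation T).
Proof.
move=> R2 x; apply/fsfunP => n; rewrite dilationE !dilation_adjE /=.
case: eqP => [->|n0]; first exact: dilation_blockK1.
case: eqP => [->|n1]; first exact: dilation_blockK2.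
by do 2![case: eqP => [h|_]; first by exfalso; lia]; rewrite addrK.
Qed.

Theorem theorem2p4 (R : starRingType) (V : iipmType R) (T : {linear V -> V}) :
  char_two R -> self_adjoint T ->
  [/\ unitary (dilation T),
      (forall (n : nat) (v : V),
         iter n T v = dsum_proj 0 (iter n (dilation T) (dsum_in 0 v)))
    & (forall Ts : {linear V -> V}, adjoint_of T Ts ->
       forall Us : {linear dsum int V -> dsum int V},
         adjoint_of (dilation T) Us ->
       forall (n : nat) (v : V),
         iter n Ts v = dsum_proj 0 (iter n Us (dsum_in 0 v)))].
Proof.
move=> R2 TT; split.
- exists (dilation_adj T); split.
  + exact: dilation_adjP.
  + exact: dilation_adjK.
  + exact: dilationK.
- by move=> n v; rewrite /dsum_proj; case: (iter_dilation T n v) => ->.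
move=> Ts TTs Us UUs n v.
(* Uniqueness of adjoints turns the arbitrary [Ts] and [Us] into [T] and [dilation_adj T]. *)
rewrite (eq_iter (adjoint_uniq TTs TT)).
rewrite (eq_iter (adjoint_uniq UUs (dilation_adjP TT))).
by rewrite /dsum_proj; case: (iter_dilation_adj T n v) => ->.
Qed.
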